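(* Let $\{A^i\}_{i=1}^N$ and $\{\tilde A^i\}_{i=1}^N$ be injective fMPSs of bond dimension $2n$ with Wall invariant $(-)$, both in canonical form, with Wall matrices $u$ and $\tilde u$. Then $\{A^i\}_i\sim\{\tilde A^i\}_i$ holds if and only if there exist $V\in\mathrm U(2n)$ and $e^{i\beta}\in\mathrm U(1)$ with $$\tilde A^i = e^{i\beta}V^\dagger A^i V\quad\text{for all } i.$$ The phase $e^{i\beta}$ is unique, and $V$ is unique up to replacements $V\mapsto e^{i\theta u}Ve^{i\phi\tilde u}$ with $\theta,\phi\in\mathbb R$. Moreover $\tilde u = \eta V^\dagger uV$ for some sign $\eta\in\{\pm1\}$. All of these statements remain true if the hypothesis $\{A^i\}_i\sim\{\tilde A^i\}_i$ is replaced by $\{A^i\}_i\sim_{\rm PBC}\{\tilde A^i\}_i$.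
   Context: Fix integers $N,n\ge1$ and a parity function $i\mapsto|i|\in\{0,1\}$ on $\{1,\dots,N\}$; $\sigma_x,\sigma_z$ are Pauli matrices. An fMPS of bond dimension $2n$ is a tuple $\{A^i\}_{i=1}^N$ of complex $2n\times2n$ matrices for which some $Z$ unitarily equivalent to $\sigma_z\otimes1_n$ satisfies $(-1)^{|i|}A^i=ZA^iZ$ for all $i$; canonical form means $\sum_iA^iA^{i\dagger}=1_{2n}$. It is injective with Wall invariant $(-)$ if there exist a unitary $W\in\mathrm U(2n)$ and complex $n\times n$ matrices $B^i$ with $A^i=W(\sigma_x^{|i|}\otimes B^i)W^\dagger$ for all $i$, and a fixed $l\in\mathbb N$ such that both $\{B^{i_1}\cdots B^{i_l}:\sum_k|i_k|\equiv0 \bmod 2\}$ and $\{B^{i_1}\cdots B^{i_l}:\sum_k|i_k|\equiv1\bmod 2\}$ span $\mathrm M_n(\mathbb C)$. Its Wall matrix is $u=W(\sigma_x\otimes1_n)W^\dagger$ (unique up to sign). Gauge equivalence: $\{A^i\}\sim\{\tilde A^i\}$ iff for each $L\in\mathbb N$ there is $\alpha_L$ with $\mathrm{tr}[A^{i_1}\cdots A^{i_L}]=e^{i\alpha_L}\mathrm{tr}[\tilde A^{i_1}\cdots\tilde A^{i_L}]$ for all $i_1,\dots,i_L$; $\{A^i\}\sim_{\rm PBC}\{\tilde A^i\}$ iff for each $L$ there is $\alpha_L$ with $\mathrm{tr}[uA^{i_1}\cdots A^{i_L}]=e^{i\alpha_L}\mathrm{tr}[\tilde u\tilde A^{i_1}\cdots\tilde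 A^{i_L}]$ for all $i_1,\dots,i_L$.
   Formalization: V is shown unique up to V ↦ e^{iψ}e^{iθu}Ve^{iφũ} with an extra global phase e^{iψ}; without it the uniqueness fails, since iV gives the same conjugation as V but is not of the form e^{iθu}Ve^{iφũ}. *)

(* Defs.v *)
From HB Require Import structures.
From mathcomp Require Import all_boot all_order all_algebra.
From mathcomp Require Import complex mxtens.
From mathcomp Require Import reals trigo.
Set Implicit Arguments. Unset Strict Implicit. Unset Printing Implicit Defensive.
Import Order.TTheory GRing.Theory Num.Theory.
Local Open Scope ring_scope.
Local Open Scope complex_scope.

Section FMPS.
Variable R : realType.
Local Notation C := R[i].

Definition adj {m k} (M : 'M[C]_(m, k)) : 'M[C]_(k, m) := map_mx (@conjc R) M^T.

Definition unitary {m} (U : 'M[C]_m) : Prop := U *m adj U = 1%:M /\ adj U *m U = 1%:M.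

Definition expi (a : R) : C := (cos a) +i* (sin a).

(* e^{i theta u} for a Wall matrix u (u^2 = 1): cos theta 1 + i sin theta u *)
Definition expiu {m} (theta : R) (u : 'M[C]_m) : 'M[C]_m :=
  ((cos theta)%:C) *: 1%:M + ((sin theta)*i) *: u.

Definition sigma_x : 'M[C]_2 := \matrix_(i < 2, j < 2) (if i == j then 0 else 1).
Definition sigma_z : 'M[C]_2 :=
  \matrix_(i < 2, j < 2) (if i == j then (if i == 0%N :> nat then 1 else -1) else 0).

Definition mxword {N m} (A : 'I_N -> 'M[C]_m) {L} (s : {ffun 'I_L -> 'I_N}) : 'M[C]_m :=
  \big[mulmx/1%:M]_(k < L) A (s k).

Definition wpar {N} (par : 'I_N -> bool) {L} (s : {ffun 'I_L -> 'I_N}) : bool :=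
  odd (\sum_(k < L) par (s k)).

Definition is_fMPS {N} n (par : 'I_N -> bool) (A : 'I_N -> 'M[C]_(2 * n)) : Prop :=
  exists Z : 'M[C]_(2 * n),
    (exists W : 'M[C]_(2 * n), unitary W /\ Z = W *m (sigma_z *t (1%:M : 'M[C]_n)) *m adj W)
    /\ forall i, ((-1) ^+ par i) *: A i = Z *m A i *m Z.

Definition fMPS_canonical {N m} (A : 'I_N -> 'M[C]_m) : Prop :=
  \sum_(i < N) A i *m adj (A i) = 1%:M.

Definition spans_parity {N} n (par : 'I_N -> bool) (B : 'I_N -> 'M[C]_n) (l : nat) (b : bool) : Prop :=
  forall M : 'M[C]_n, exists c : {ffun 'I_l -> 'I_N} -> C,
    M = \sum_(s : {ffun 'I_l -> 'I_N} | wpar par s == b) c s *: mxword B s.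

(* {A^i} is injective with Wall invariant (-) and u is a Wall matrix for it *)
Definition wall_minus {N} n (par : 'I_N -> bool) (A : 'I_N -> 'M[C]_(2 * n))
    (u : 'M[C]_(2 * n)) : Prop :=
  exists W : 'M[C]_(2 * n), exists B : 'I_N -> 'M[C]_n,
    [/\ unitary W,
        forall i, A i = W *m ((if par i then sigma_x else 1%:M) *t B i) *m adj W,
        exists l, spans_parity par B l false /\ spans_parity par B l true
      & u = W *m (sigma_x *t (1%:M : 'M[C]_n)) *m adj W].

Definition gauge_equiv {N m} (A At : 'I_N -> 'M[C]_m) : Prop :=
  forall L : nat, exists alpha : R, forall s : {ffun 'I_L -> 'I_N},
    \tr (mxword A s) = expi alpha * \tr (mxword At s).

Definition gauge_equiv_PBC {N m} (A At : 'I_N -> 'M[C]_m) (u ut : 'M[C]_m) : Prop :=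
  forall L : nat, exists alpha : R, forall s : {ffun 'I_L -> 'I_N},
    \tr (u *m mxword A s) = expi alpha * \tr (ut *m mxword At s).

Definition related {N m} (A At : 'I_N -> 'M[C]_m) (V : 'M[C]_m) (beta : R) : Prop :=
  unitary V /\ forall i, At i = expi beta *: (adj V *m A i *m V).

End FMPS.

(* Main.v *)
Require Import Defs.
From HB Require Import structures.
From mathcomp Require Import all_boot all_order all_algebra spectral sesquilinear.
From mathcomp Require Import complex mxtens ring lra.
From mathcomp Require Import boolp reals trigo.
Set Implicit Arguments. Unset Strict Implicit. Unset Printing Implicit Defensive.
Import Order.TTheory GRing.Theory Num.Theory.
Local Open Scope ring_scope.

(** A word in the [A i] is, up to conjugation by [W], [sigma_x^p] tensored with the
    same word in the [B i], where [p] is the parity of the word; so its trace,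
    without or with the Wall matrix inserted, is twice the trace of the [B]-word when
    the parity is even or odd respectively, and zero otherwise.  Either gauge
    equivalence thus compares the traces of [B]- and [B']-words of one parity [b0].

    For large [L] the words of length [L] and parity [b] span all matrices, and by
    nondegeneracy of the trace form (pairing with words of parity [b + b0]) the
    assignment [B]-word |-> [B']-word extends to linear bijections [phi_{b,L}], which
    are multiplicative in the graded sense.  Then [phi_{b,L}(1)] is central, hence a
    scalar, of modulus 1 by the trace condition, and [phi_{0,l}] is a multiple of an
    inner automorphism.  This gives [B' i = lam (+-1)^|i| T B_i T^-1]; the sign is
    absorbed by [sigma_z].  By canonicity [T^-1 T^-*] is a fixed point of
    [X |-> \sum_i B_i X B_i^*], whose fixed points are scalar, so [T] can be taken
    unitary.

    For uniqueness, a matrix intertwining [A] with [w A] intertwines all words of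
    length [l] with factor [w^l]; since both lengths [l] and [l+1] produce the
    identity, [w = 1], and the commutant of the [A i] is spanned by [1] and [u]. *)

(** * Words in a tuple of matrices and their graded linear spans *)

Section Words.
Variables (F : fieldType) (N : nat) (par : 'I_N -> bool).

Definition word {n} (B : 'I_N -> 'M[F]_n) (t : seq 'I_N) : 'M[F]_n :=
  foldr (fun i M => B i *m M) 1%:M t.

Definition spar (t : seq 'I_N) : bool := foldr (fun i b => par i (+) b) false t.

Lemma word_cat n (B : 'I_N -> 'M[F]_n) s t : word B (s ++ t) = word B s *m word B t.
Proof. by elim: s => [|i s IH] /=; rewrite ?mul1mx // IH mulmxA. Qed.

Lemma spar_cat s t : spar (s ++ t) = spar s (+) spar t.
Proof. by elim: s => [|i s IH] //=; rewrite IH addbA. Qed.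

(** Graph of the correspondence sending each [B]-word to the same [B']-word, extended linearly. A
    relation makes sense before the correspondence is known to be single-valued, and it can be
    reversed. The sizes differ when words in the [A i] are paired with words in the [B i]. *)
Inductive wspan {n m} (B : 'I_N -> 'M[F]_n) (B' : 'I_N -> 'M[F]_m) (b : bool) (L : nat) :
    'M[F]_n -> 'M[F]_m -> Prop :=
| wspan0 : wspan B B' b L 0 0
| wspan_cons a t X Y : size t = L -> spar t = b -> wspan B B' b L X Y ->
    wspan B B' b L (a *: word B t + X) (a *: word B' t + Y).

(** With [B] on both sides, [Y] is forced to equal [X]; the existential avoids having to prove
    it. *)
Definition full {n} (B : 'I_N -> 'M[F]_n) b L := forall X, exists Y, wspan B B b L X Y.

Section Pair.
Variables (n m : nat) (B : 'I_N -> 'M[F]_n) (B' : 'I_N -> 'M[F]_m).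

Lemma wspan_sym b L X Y : wspan B B' b L X Y -> wspan B' B b L Y X.
Proof. by elim=> *; constructor. Qed.

Lemma wspan_word t : wspan B B' (spar t) (size t) (word B t) (word B' t).
Proof.
have := @wspan_cons _ _ B B' (spar t) (size t) 1 t 0 0 erefl erefl (wspan0 _ _ _ _).
by rewrite !scale1r !addr0.
Qed.

Lemma wspanD b L X Y X' Y' : wspan B B' b L X Y -> wspan B B' b L X' Y' ->
  wspan B B' b L (X + X') (Y + Y').
Proof.
by move=> + h'; elim=> [|a t X0 Y0 st pt _ IH]; rewrite ?add0r // -!addrA; constructor.
Qed.

Lemma wspanZ b L a X Y : wspan B B' b L X Y -> wspan B B' b L (a *: X) (a *: Y).
Proof.
elim=> [|c t X0 Y0 st pt _ IH]; first by rewrite !scaler0; constructor.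
by rewrite !scalerDr !scalerA; constructor.
Qed.

Lemma wspanB b L X Y X' Y' : wspan B B' b L X Y -> wspan B B' b L X' Y' ->
  wspan B B' b L (X - X') (Y - Y').
Proof.
move=> h /(wspanZ (-1)); rewrite !scaleN1r; exact: wspanD.
Qed.

Lemma wspan_sum (I : Type) (r : seq I) (P : pred I) b L (X : I -> 'M_n) (Y : I -> 'M_m) :
  (forall i, P i -> wspan B B' b L (X i) (Y i)) ->
  wspan B B' b L (\sum_(i <- r | P i) X i) (\sum_(i <- r | P i) Y i).
Proof.
move=> h; elim: r => [|i r IH]; first by rewrite !big_nil; constructor.
by rewrite !big_cons; case: ifP => // Pi; apply: wspanD; auto.
Qed.

Lemma wspanM b L b' L' X Y X' Y' : wspan B B' b L X Y -> wspan B B' b' L' X' Y' ->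
  wspan B B' (b (+) b') (L + L') (X *m X') (Y *m Y').
Proof.
elim=> [|a t X0 Y0 <- <- _ IH h']; first by rewrite !mul0mx; constructor.
rewrite !mulmxDl; apply: wspanD; last exact: IH.
elim: h' => [|a' t' X1 Y1 <- <- _ IH']; first by rewrite !mulmx0; constructor.
rewrite !mulmxDr; apply: wspanD => //.
rewrite -!scalemxAr -!scalemxAl -!word_cat -spar_cat -size_cat.
by do 2!apply: wspanZ; apply: wspan_word.
Qed.

Lemma wspan_letter i : wspan B B' (par i) 1 (B i) (B' i).
Proof. by have := wspan_word [:: i]; rewrite /= !mulmx1 addbF. Qed.

Lemma full_image b L X : full B b L -> exists Y, wspan B B' b L X Y.
Proof.
move=> /(_ X)[Z]; elim=> [|a t X0 Y0 st pt _ [Y hY]]; first by exists 0; constructor.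
by exists (a *: word B' t + Y); constructor.
Qed.

Lemma wspan_mxtrace (e : F) b L X Y :
  wspan B B' b L X Y ->
  (forall t, size t = L -> spar t = b ->
     \tr (word B t) = e * \tr (word B' t)) -> \tr X = e * \tr Y.
Proof.
move=> + h; elim=> [|a t X0 Y0 st pt _ IH]; first by rewrite !mxtrace0 mulr0.
by rewrite !mxtraceD !mxtraceZ IH h // mulrDr mulrCA.
Qed.

End Pair.

(** Write [X] as the sum of the [B i *m (B' i *m X)] and expand [B' i *m X] in words whose parity
    completes [par i] to [b]. Canonical form supplies [B' i = adj (B i)], so spanning at one length
    passes to all larger ones. *)
Lemma fullS n (B B' : 'I_N -> 'M[F]_n) L : \sum_i B i *m B' i = 1%:M ->
  (forall b, full B b L) -> forall b, full B b L.+1.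
Proof.
move=> eq1 fL b X.
have /choice[Y hY] i : exists Y, wspan B B (par i (+) b) L (B' i *m X) Y by apply: fL.
exists (\sum_i B i *m Y i).
rewrite -[X]mul1mx -eq1 mulmx_suml; apply: wspan_sum => i _.
rewrite -mulmxA -add1n -[b](addKb (par i)).
exact: wspanM (wspan_letter _ _ _) (hY i).
Qed.

Lemma full_geq n (B B' : 'I_N -> 'M[F]_n) L L' : \sum_i B i *m B' i = 1%:M ->
  (forall b, full B b L) -> (L <= L')%N -> forall b, full B b L'.
Proof.
move=> eq1 fL /subnK<-; elim: (L' - L)%N => // k IH.
by rewrite addSn; apply: fullS eq1 IH.
Qed.

End Words.

(** * Trace form, centre and automorphisms of a full matrix algebra *)

Lemma mxtrace_mul_eq0 (F : fieldType) n (X : 'M[F]_n) :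
  (forall Y, \tr (X *m Y) = 0) -> X = 0.
Proof.
move=> h; apply/matrixP=> i j; rewrite mxE -(h (delta_mx j i)) mxtrace_mulC.
rewrite /mxtrace (bigD1 j) //= big1 => [|k kj].
  rewrite addr0 !mxE (bigD1 i) //= big1 => [|k ki]; rewrite !mxE ?eqxx ?mul1r ?addr0 //.
  by rewrite (negbTE ki) andbF mul0r.
by rewrite !mxE big1 // => k' _; rewrite !mxE (negbTE kj) mul0r.
Qed.

Lemma comm_all_scalar (F : fieldType) n (X : 'M[F]_n.+1) :
  (forall Y, X *m Y = Y *m X) -> X = (X 0 0)%:M.
Proof.
move=> h; apply/matrixP=> i j; rewrite mxE.
have /matrixP/(_ i 0) := h (delta_mx j 0).
rewrite !mxE (bigD1 j) //= big1 => [|k kj]; rewrite !mxE ?eqxx ?mulr1 ?addr0; last first.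
  by rewrite (negbTE kj) mulr0.
rewrite (bigD1 0) //= big1 => [|k kj]; rewrite !mxE ?eqxx ?(negbTE kj) ?andbF ?mul0r //.
by rewrite andbT addr0 => ->; case: eqP => _; rewrite ?mul1r ?mul0r.
Qed.

(* Skolem-Noether: [T] is built from the images of the first column of matrix units. *)
Lemma inner_of_mul (F : fieldType) n (f : 'M[F]_n.+1 -> 'M[F]_n.+1) (c : F) :
  c != 0 -> (forall a X Y, f (a *: X + Y) = a *: f X + f Y) ->
  (forall X Y, f X *m f Y = c *: f (X *m Y)) -> f (delta_mx 0 0) != 0 ->
  exists2 T, T \in unitmx & forall X, f X = c *: (T *m X *m invmx T).
Proof.
move=> c0 flin fmul f0.
have f00 : f 0 = 0 by have := flin 1 0 0; rewrite !scale1r addr0 -[LHS]addr0 => /addrI.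
have fsum (I : finType) (a : I -> F) (X : I -> 'M_n.+1) :
    f (\sum_i a i *: X i) = \sum_i a i *: f (X i).
  by elim/big_rec2: _ => [|i Y Z _ <-]; rewrite ?f00 ?flin.
have /existsP[[p q] /= fpq] : [exists ij : 'I_n.+1 * 'I_n.+1, f (delta_mx 0 0) ij.1 ij.2 != 0].
  apply: contraR f0 => /existsPn h; apply/eqP/matrixP=> i j.
  by rewrite mxE; apply/eqP/negPn/(h (i, j)).
pose E (i j : 'I_n.+1) : 'M[F]_n.+1 := delta_mx i j.
(* Column [i] of [T] is column [q] of [f (E i 0)], so [fmul] turns left multiplication by [f X] into
   [c] times right multiplication of [T] by [X]. *)
pose T := \sum_i f (E i 0) *m E q 0 *m E 0 i.
have fT X : f X *m T = c *: (T *m X).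
  rewrite mulmx_sumr mulmx_suml scaler_sumr.
  transitivity (\sum_i \sum_k c *: (X k i *: (f (E k 0) *m E q 0 *m E 0 i))).
    apply: eq_bigr => i _.
    have XE : X *m E i 0 = \sum_k X k i *: E k 0.
      apply/matrixP=> a b; rewrite summxE (bigD1 a) //= big1 => [|k ka].
        rewrite mxE (bigD1 i) //= big1 => [|k ki]; rewrite !mxE ?eqxx ?addr0 //.
        by rewrite (negbTE ki) mulr0.
      by rewrite !mxE eq_sym (negbTE ka) mulr0.
    rewrite !mulmxA fmul XE fsum -!scalemxAl !mulmx_suml scaler_sumr.
    by apply: eq_bigr => k _; rewrite -!scalemxAl.
  rewrite exchange_big /=; apply: eq_bigr => k _.
  rewrite -scaler_sumr -!mulmxA; congr (_ *: _).
  have -> : E 0 k *m X = \sum_i X k i *: E 0 i.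
    apply/matrixP=> a b; rewrite summxE (bigD1 b) //= big1 => [|i ib].
      rewrite mxE (bigD1 k) //= big1 => [|k' ki]; rewrite !mxE ?eqxx ?andbT ?addr0.
        by rewrite mulrC.
      by rewrite (negbTE ki) andbF mul0r.
    by rewrite !mxE [b == _]eq_sym (negbTE ib) andbF mulr0.
  by rewrite !mulmx_sumr; apply: eq_bigr => i _; rewrite -!scalemxAr !mulmxA.
(* This entry is [f (E 0 0) p q], nonzero by the choice of [p] and [q]. *)
have Tp0 : T p 0 != 0.
  rewrite /T summxE (bigD1 0) //= big1 => [|i i0]; last first.
    by rewrite mxE big1 // => k _; rewrite !mxE [0 == i]eq_sym (negbTE i0) andbF mulr0.
  rewrite addr0 mxE (bigD1 0) //= big1 => [|k k0]; rewrite !mxE ?eqxx; last first.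
    by rewrite (negbTE k0) mulr0.
  rewrite addr0 mulr1 (bigD1 q) //= big1 => [|k kq]; rewrite !mxE ?eqxx; last first.
    by rewrite (negbTE kq) mulr0.
  by rewrite addr0 mulr1.
have Tu : T \in unitmx.
  rewrite -row_full_unit -sub1mx; apply/row_subP=> i.
  (* By [fT], row [p] of [f (E 0 i) *m T] is [c * T p 0] times the [i]-th basis row, so the row
     space of [T] is everything. *)
  have -> : row i 1%:M = (T p 0 * c)^-1 *: (row p (f (E 0 i)) *m T).
    rewrite -row_mul fT; apply/rowP=> j; rewrite !mxE (bigD1 0) //= big1 => [|k k0].
      by rewrite mxE eqxx addr0 [c * (_ * _)]mulrA [c * _]mulrC mulKf ?mulf_neq0 //; rewrite eq_sym.
    by rewrite mxE (negbTE k0) mulr0.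
  by rewrite scalemx_sub // submxMl.
exists T => // X.
by rewrite -[LHS](mulmxK Tu) fT -scalemxAl.
Qed.

(** * Matrix tuples whose word traces of one parity agree up to phases *)

Section TraceRigidity.
Variables (F : numFieldType) (N n : nat) (par : 'I_N -> bool).
Variables (B B' : 'I_N -> 'M[F]_n.+1) (l : nat) (b0 : bool) (e : nat -> F).
Hypothesis fB : forall b L, (l <= L)%N -> full par B b L.
Hypothesis fB' : forall b L, (l <= L)%N -> full par B' b L.
Hypothesis norm_e : forall L, `|e L| = 1.
Hypothesis tr_word : forall t, spar par t = b0 ->
  \tr (word B t) = e (size t) * \tr (word B' t).

Local Notation G := (wspan par B B').

Let e_neq0 L : e L != 0.
Proof. by rewrite -normr_eq0 norm_e oner_eq0. Qed.

Let tr_G L X Y : G b0 L X Y -> \tr X = e L * \tr Y.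
Proof. by move/wspan_mxtrace; apply=> t <- /tr_word. Qed.

(* Pairing with words of the complementary parity makes both traces comparable. *)
Let G_inj b L X Y Y' : (l <= L)%N -> G b L X Y -> G b L X Y' -> Y = Y'.
Proof.
move=> lL /wspanB h /h{h}; rewrite subrr => h; apply/eqP; rewrite -subr_eq0; apply/eqP.
apply: mxtrace_mul_eq0 => Z.
have [X' /wspan_sym h'] := full_image B Z (@fB' (b (+) b0) L lL).
have := wspanM h h'; rewrite addKb => /tr_G/eqP.
by rewrite mul0mx mxtrace0 eq_sym mulf_eq0 (negbTE (e_neq0 _)) => /eqP.
Qed.

Let G_inj_l b L X X' Y : (l <= L)%N -> G b L X Y -> G b L X' Y -> X = X'.
Proof.
move=> lL /wspanB h /h{h}; rewrite subrr => h; apply/eqP; rewrite -subr_eq0; apply/eqP.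
apply: mxtrace_mul_eq0 => Z.
have [Y' h'] := full_image B' Z (@fB (b (+) b0) L lL).
have := wspanM h h'; rewrite addKb => /tr_G.
by rewrite mul0mx mxtrace0 mulr0.
Qed.

(* The image of [1] commutes with everything, because [1 X = X 1]. *)
Let G_one b L Y : (l <= L)%N -> G b L 1%:M Y -> Y = (Y 0 0)%:M.
Proof.
move=> lL h; apply: comm_all_scalar => Z.
have [X /wspan_sym h'] := full_image B Z (@fB' b L lL).
have := wspanM h h'; have := wspanM h' h; rewrite mulmx1 mul1mx => h1 h2.
exact: G_inj (leq_trans lL (leq_addr _ _)) h2 h1.
Qed.

Lemma trace_rigidity : exists T lam (k : bool),
  [/\ T \in unitmx, `|lam| = 1 &
      forall i, B' i = (lam * (-1) ^+ (k && par i)) *: (T *m B i *m invmx T)].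
Proof.
have /choice[phi hphi] (p : bool * nat * 'M[F]_n.+1) :
    exists Y, (l <= p.1.2)%N -> G p.1.1 p.1.2 p.2 Y.
  case: p => [[b L] X] /=; have [lL|] := boolP (l <= L)%N; last by exists 0.
  by have [Y hY] := full_image B' X (fB b lL); exists Y.
pose f X := phi (false, l, X).
have Gf X : G false l X (f X) by apply: (hphi (false, l, X)).
pose c b L := phi (b, L, 1%:M) 0 0.
have Gc b L : (l <= L)%N -> G b L 1%:M (c b L)%:M.
  by move=> lL; have h := hphi (b, L, 1%:M) lL; rewrite /c -(G_one lL h).
have cM b L b' L' : (l <= L)%N -> (l <= L')%N -> c b L * c b' L' = c (b (+) b') (L + L')%N.
  move=> lL lL'; have lLL := leq_trans lL (leq_addr L' L).
  have := wspanM (Gc b _ lL) (Gc b' _ lL'); rewrite mulmx1 -scalar_mxM => h.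
  by have /matrixP/(_ 0 0) := G_inj lLL h (Gc _ _ lLL); rewrite !mxE.
have n0 : (n.+1)%:R != 0 :> F by rewrite pnatr_eq0.
have cb0 L : (l <= L)%N -> `|c b0 L| = 1.
  move=> lL; have := tr_G (Gc b0 L lL).
  rewrite !mxtrace_scalar -(mulr_natr (c b0 L)) mulrA -[LHS]mul1r => /(mulIf n0).
  by move/(congr1 Num.norm); rewrite normrM norm_e mul1r normr1.
(* The trace condition only reaches parity [b0]. For arbitrary [b], adding [b] twice to [b0] gives
   [b0] again, so [c b L] squared is a quotient of two numbers of modulus 1. *)
have cn b L : (l <= L)%N -> `|c b L| = 1.
  move=> lL; have lLL := leq_trans lL (leq_addr L L).
  have : c b L * c b L * c b0 L = c b0 (L + L + L)%N by rewrite !cM // addbb.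
  move/(congr1 Num.norm); rewrite [in RHS]cb0 ?(leq_trans lL (leq_addl _ _)) //.
  rewrite !normrM cb0 // mulr1 -expr2 => /eqP.
  by rewrite sqrf_eq1 => /orP[/eqP //|/eqP h]; have := normr_ge0 (c b L); rewrite h oppr_ge0 ler10.
have c0 b L : (l <= L)%N -> c b L != 0 by move=> lL; rewrite -normr_eq0 cn // oner_eq0.
have flin a X Y : f (a *: X + Y) = a *: f X + f Y.
  exact: G_inj (leqnn l) (Gf _) (wspanD (wspanZ a (Gf X)) (Gf Y)).
(* Comparing [1 X] with [X 1] at length [L + l] shows that every correspondence is a scalar multiple
   of [f]. *)
have fscale b L X Y : (l <= L)%N -> G b L X Y -> c false l *: Y = c b L *: f X.
  move=> lL h; have := wspanM h (Gc false l (leqnn l)).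
  have := wspanM (Gc b L lL) (Gf X); rewrite mul1mx mulmx1 mul_scalar_mx mul_mx_scalar => h1 h2.
  exact: G_inj (leq_trans lL (leq_addr _ _)) h2 h1.
have fmul X Y : f X *m f Y = c false l *: f (X *m Y).
  have ll := leq_addr l l.
  apply: (scalerI (c0 false l (leqnn l))); rewrite (fscale _ _ _ _ ll (wspanM (Gf X) (Gf Y))).
  by rewrite -cM // scalerA.
have f0 : f (delta_mx 0 0) != 0.
  apply/eqP=> f0; have := Gf (delta_mx 0 0); rewrite f0 => h.
  have /matrixP/(_ 0 0)/eqP := G_inj_l (leqnn l) h (wspan0 _ _ _ _ _).
  by rewrite !mxE !eqxx oner_eq0.
have [T Tu fE] := inner_of_mul (c0 false l (leqnn l)) flin fmul f0.
(* [B i] has length 1, possibly below [l]; multiplied by the identity at length [l] it reaches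
   length [l.+1], where [fscale] applies. *)
pose lam b := c b l.+1 / c false l.
have BE i : B' i = lam (par i) *: (T *m B i *m invmx T).
  have := wspanM (wspan_letter par B B' i) (Gc false l (leqnn l)).
  rewrite mulmx1 mul_mx_scalar addbF add1n => /(fscale _ _ _ _ (leqnSn l)).
  rewrite fE !scalerA => /(congr1 (fun X => (c false l * c false l)^-1 *: X)).
  have cc : c false l * c false l != 0 by rewrite mulf_neq0 ?c0.
  rewrite !scalerA mulVf // scale1r => ->; congr (_ *: _).
  by rewrite /lam invfM mulrACA mulVf ?c0 // mulr1 mulrC.
(* Two equal parities add up to even, so both squares of [c] at length [l.+1] are [c false] at twice
   that length; hence the [lam] differ at most by a sign, recorded in [k]. *)
have lam2 : lam true ^+ 2 = lam false ^+ 2.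
  by rewrite /lam !expr_div_n !expr2 cM ?leqnSn // [in RHS]cM ?leqnSn.
exists T, (lam false), (lam true != lam false); split=> // [|i].
  by rewrite normrM normfV !cn ?leqnSn // mul1r invr1.
rewrite BE; congr (_ *: _); case: (par i); last by rewrite andbF mulr1.
move/eqP: lam2; rewrite eqf_sqr andbT; case: eqVneq => [->|_] /=; first by rewrite mulr1.
by move/eqP->; rewrite mulrN1.
Qed.

End TraceRigidity.

(** * Adjoints, unitary matrices and positive quadratic forms *)

Section Adjoint.
Variable R : realType.
Local Notation C := R[i].

Lemma adjE m k (M : 'M[C]_(m, k)) i j : adj M i j = (M j i)^*.
Proof. by rewrite !mxE. Qed.

Lemma adjM m k p (M : 'M[C]_(m, k)) (M' : 'M_(k, p)) : adj (M *m M') = adj M' *m adj M.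
Proof. by rewrite /adj trmx_mul map_mxM. Qed.

Lemma adjK m k (M : 'M[C]_(m, k)) : adj (adj M) = M.
Proof. by apply/matrixP=> i j; rewrite !adjE conjCK. Qed.

Lemma adjD m k (M M' : 'M[C]_(m, k)) : adj (M + M') = adj M + adj M'.
Proof. by rewrite /adj linearD map_mxD. Qed.

Lemma adjZ m k a (M : 'M[C]_(m, k)) : adj (a *: M) = a^* *: adj M.
Proof. by rewrite /adj linearZ /= map_mxZ. Qed.

Lemma adj_1mx m : adj (1%:M : 'M[C]_m) = 1%:M.
Proof. by rewrite /adj trmx1 map_mx1. Qed.

Lemma adj_0mx m k : adj (0 : 'M[C]_(m, k)) = 0.
Proof. by rewrite /adj trmx0 map_mx0. Qed.

Lemma adj_tens m k p q (M : 'M[C]_(m, k)) (M' : 'M[C]_(p, q)) : adj (M *t M') = adj M *t adj M'.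
Proof. by rewrite /adj trmx_tens map_mxT. Qed.

Lemma tens11 m k : (1%:M : 'M[C]_m) *t (1%:M : 'M[C]_k) = 1%:M.
Proof.
apply/matrixP=> i j; case: (mxtens_indexP i) => i1 i2; case: (mxtens_indexP j) => j1 j2.
rewrite tensmxE !mxE (can_eq (@mxtens_indexK _ _)) xpair_eqE -mulnb natrM.
by [].
Qed.

Lemma unitary_adj m (U : 'M[C]_m) : unitary U -> unitary (adj U).
Proof. by case=> h1 h2; split; rewrite adjK. Qed.

Lemma unitary_mul m (U V : 'M[C]_m) : unitary U -> unitary V -> unitary (U *m V).
Proof.
case=> U1 U2 [V1 V2]; split; rewrite adjM mulmxA.
  by rewrite -(mulmxA U) V1 mulmx1.
by rewrite -(mulmxA (adj V)) U2 mulmx1.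
Qed.

Lemma unitary_tens m k (U : 'M[C]_m) (V : 'M[C]_k) : unitary U -> unitary V -> unitary (U *t V).
Proof.
case=> U1 U2 [V1 V2]; split; rewrite adj_tens tensmx_mul.
  by rewrite U1 V1 tens11.
by rewrite U2 V2 tens11.
Qed.

Lemma unitary_scale m (a : C) (U : 'M[C]_m) : `|a| = 1 -> unitary U -> unitary (a *: U).
Proof.
move=> a1 [U1 U2].
have aa : a * a^* = 1 by rewrite -normCK a1 expr1n.
by split; rewrite adjZ -scalemxAl -scalemxAr scalerA ?[_^* * _]mulrC aa scale1r.
Qed.

Lemma hermitian_diag n (P : 'M[C]_n) : adj P = P ->
  exists (Q : 'M[C]_n) (d : 'rV[C]_n), [/\ unitary Q, forall i, d 0 i \is Num.real & P = adj Q *m diag_mx d *m Q].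
Proof.
move=> hP; have hP' : P \is hermsymmx.
  by apply/is_hermitianmxP; rewrite expr0 scale1r; symmetry.
exists (spectralmx P), (spectral_diag P).
have Qu := spectral_unitarymx P.
have Q1 : adj (spectralmx P) = invmx (spectralmx P) by rewrite invmx_unitary.
split; first by split; rewrite Q1 ?mulmxV ?mulVmx ?unitarymx_unit.
  by move=> i; have /mxOverP := hermitian_spectral_diag_real hP'; apply.
by rewrite Q1; apply/orthomx_spectralP/hermitian_normalmx.
Qed.

Definition qform n (S : 'M[C]_n) (x : 'cV[C]_n) : C := (adj x *m S *m x) 0 0.

Section PSD.
Variables (n : nat) (Q : 'M[C]_n) (e : 'rV[C]_n).
Hypothesis e_ge0 : forall k, 0 <= e 0 k.
Let S := adj Q *m diag_mx e *m Q.

Lemma qform_psdE x : qform S x = \sum_k e 0 k * `|(Q *m x) k 0| ^+ 2.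
Proof.
rewrite /qform /S !mulmxA -adjM -mulmxA mxE; apply: eq_bigr => k _.
rewrite mul_mx_diag mxE adjE normCK; rewrite mulrAC mulrC; congr (_ * _).
by rewrite mulrC.
Qed.

Lemma qform_psd_ge0 x : 0 <= qform S x.
Proof. by rewrite qform_psdE sumr_ge0 // => k _; rewrite mulr_ge0 ?exprn_ge0. Qed.

(** Every nonnegative term [e 0 k * |(Q x) k|^2] vanishes, and either factor being zero kills entry
    [k] of [diag_mx e *m (Q *m x)]. *)
Lemma qform_psd_eq0 x : qform S x = 0 -> S *m x = 0.
Proof.
rewrite qform_psdE => /eqP; rewrite psumr_eq0 => [/allP h|k _]; last first.
  by rewrite mulr_ge0 ?exprn_ge0.
rewrite /S -!mulmxA; suff -> : diag_mx e *m (Q *m x) = 0 by rewrite mulmx0.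
apply/matrixP=> k j; rewrite (ord1 j) mul_diag_mx !mxE.
have := h k (mem_index_enum _); rewrite mulf_eq0 sqrf_eq0 normr_eq0.
by case/orP=> /eqP; [move->; rewrite mul0r | rewrite mxE => ->; rewrite mulr0].
Qed.

End PSD.

(** * Positive fixed points of the transfer map and unitarity of the intertwiner *)

Section FixedPoint.
Variables (N n : nat) (par : 'I_N -> bool) (B : 'I_N -> 'M[C]_n.+1) (b : bool) (L : nat).
Hypothesis canB : \sum_i B i *m adj (B i) = 1%:M.
Hypothesis fullB : full par B b L.

(* Subtracting the least eigenvalue leaves a singular positive fixed point; its
   kernel is stable under all [adj (B i)], hence everything. *)
Lemma fixed_point_scalar P : adj P = P -> \sum_i B i *m P *m adj (B i) = P ->
  exists mu, P = mu%:M.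
Proof.
move=> hP fixP; have [Q [d [Qu dR PE]]] := hermitian_diag hP.
pose i0 := [arg min_(i < 0 : 'I_n.+1) complex.Re (d 0 i)]%O.
have dmin i : d 0 i0 <= d 0 i.
  rewrite -[d 0 i]RRe_real // -[d 0 i0]RRe_real // lecR /i0.
  by case: arg_minP => // j _; apply.
set mu := d 0 i0; exists mu; apply/eqP; rewrite -subr_eq0; apply/eqP.
pose e : 'rV[C]_n.+1 := \row_k (d 0 k - mu).
have e0 k : 0 <= e 0 k by rewrite mxE subr_ge0.
set S := P - _.
have SE : S = adj Q *m diag_mx e *m Q.
  have -> : diag_mx e = diag_mx d - mu%:M.
    by apply/matrixP=> i j; rewrite !mxE; case: eqP => [->|] //; rewrite ?mulr0n ?subr0.
  rewrite mulmxBr mulmxBl -PE; congr (_ - _).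
  by rewrite mul_mx_scalar -scalemxAl Qu.2 scalemx1.
have fixS : \sum_i B i *m S *m adj (B i) = S.
  rewrite /S; under eq_bigr do rewrite mulmxBr mulmxBl mul_mx_scalar -scalemxAl.
  by rewrite sumrB fixP -scaler_sumr canB scalemx1.
clearbody S.
have kerB i (x : 'cV_n.+1) : S *m x = 0 -> S *m (adj (B i) *m x) = 0.
  move=> Sx; have q0 : qform S x = 0 by rewrite /qform -mulmxA Sx mulmx0 mxE.
  (* By [fixS] these nonnegative numbers add up to [qform S x], which is zero. *)
  have /eqP : \sum_i qform S (adj (B i) *m x) = 0.
    rewrite -[RHS]q0 /qform -[in RHS]fixS mulmx_sumr mulmx_suml summxE.
    by apply: eq_bigr => j _; rewrite adjM adjK !mulmxA.
  rewrite SE psumr_eq0 => [/allP h|j _]; last exact: qform_psd_ge0.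
  by apply: qform_psd_eq0 => //; apply/eqP/(h i (mem_index_enum _)).
have kerw t (x : 'cV_n.+1) : S *m x = 0 -> S *m (adj (word B t) *m x) = 0.
  elim: t x => [|i t IH] x Sx /=; first by rewrite adj_1mx mul1mx.
  by rewrite adjM -mulmxA; apply: IH; apply: kerB.
have kerM M (x : 'cV_n.+1) : S *m x = 0 -> S *m (adj M *m x) = 0.
  move=> Sx; have [Y] := fullB M; elim=> [|a t X Y' _ _ _ IH].
    by rewrite adj_0mx mul0mx mulmx0.
  by rewrite adjD adjZ mulmxDl mulmxDr IH addr0 -scalemxAl -scalemxAr kerw // scaler0.
(* An eigenvector of [P] for the least eigenvalue. *)
have Sx : S *m (adj Q *m (delta_mx i0 0 : 'cV_n.+1)) = 0.
  rewrite SE -!mulmxA [Q *m _]mulmxA Qu.1 mul1mx.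
  suff -> : diag_mx e *m (delta_mx i0 0 : 'cV_n.+1) = 0 by rewrite mulmx0.
  apply/matrixP=> k j; rewrite mul_diag_mx !mxE.
  by case: eqP => [->|]; rewrite ?subrr ?mul0r ?mulr0.
apply/matrixP=> i j; rewrite [RHS]mxE.
(* This matrix carries the kernel vector to the [j]-th basis vector, so column [j] of [S]
   vanishes. *)
have := kerM (adj (delta_mx j i0 *m Q)) _ Sx; rewrite adjK !mulmxA -(mulmxA _ Q) Qu.1 mulmx1.
rewrite -mulmxA mul_delta_mx -colE => /matrixP/(_ i 0); by rewrite !mxE.
Qed.

(** Once [T^-1] times its adjoint is a scalar [mu > 0], dividing [T^-1] by the square root of [mu]
    gives a unitary and leaves the conjugation unchanged. *)
Lemma unitary_of_canonical (B' : 'I_N -> 'M[C]_n.+1) T (lam : 'I_N -> C) :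
  T \in unitmx -> (forall i, `|lam i| = 1) ->
  (forall i, B' i = lam i *: (T *m B i *m invmx T)) ->
  \sum_i B' i *m adj (B' i) = 1%:M ->
  exists2 v, unitary v & forall i, B' i = lam i *: (adj v *m B i *m v).
Proof.
move=> Tu lam1 BE canB'; pose P := invmx T *m adj (invmx T).
have hP : adj P = P by rewrite /P adjM adjK.
have fixP : \sum_i B i *m P *m adj (B i) = P.
  (* The canonical form of [B'], multiplied by [T^-1] and its adjoint, becomes the fixed point
     equation for [P]. *)
  transitivity (invmx T *m 1%:M *m adj (invmx T)); last by rewrite mulmx1.
  rewrite -canB' mulmx_sumr mulmx_suml.
  apply: eq_bigr => i _; rewrite BE adjZ -scalemxAl -!scalemxAr -!scalemxAl.
  rewrite scalerA -normCK lam1 expr1n scale1r !adjM /P.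
  have aT : adj T *m adj (invmx T) = 1%:M by rewrite -adjM mulVmx // adj_1mx.
  move: (adj T) (adj (invmx T)) (adj (B i)) aT => U U' V UU'.
  by rewrite !mulmxA mulVmx // mul1mx -[in RHS](mulmxA _ U) UU' mulmx1.
have [mu Pmu] := fixed_point_scalar hP fixP.
have muE : mu = \sum_k `|invmx T 0 k| ^+ 2.
  have /matrixP/(_ 0 0) := Pmu; rewrite !mxE eqxx mulr1n => <-.
  by apply: eq_bigr => k _; rewrite adjE normCK.
have mu_ge0 : 0 <= mu by rewrite muE sumr_ge0 // => k _; rewrite exprn_ge0.
have mu0 : mu != 0.
  apply/eqP => mu0; move: Pmu; rewrite mu0 raddf0 /P => /(congr1 (mulmx T)).
  rewrite mulKVmx // mulmx0 => /(congr1 (@adj R _ _)); rewrite adjK adj_0mx => Ti0.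
  by move: Tu; rewrite -unitmx_inv Ti0 unitmxE det0 unitr0.
pose s := sqrtC mu; have s2 : s ^+ 2 = mu by rewrite sqrtCK.
have sR : (s^-1)^* = s^-1 by apply/CrealP; rewrite ger0_real // invr_ge0 sqrtC_ge0.
have s0 : s != 0 by rewrite sqrtC_eq0.
pose v := s^-1 *: invmx T.
have vv : v *m adj v = 1%:M.
  rewrite /v adjZ -scalemxAl -scalemxAr scalerA -/P Pmu sR -invfM -expr2 s2.
  by rewrite scale_scalar_mx mulVf.
have vE : adj v = s *: T.
  rewrite -[LHS]mul1mx -(mulmxV Tu) -mulmxA -[invmx T](scalerK s0) scalerA.
  by rewrite mulrC -scalerA -/v -scalemxAl vv -scalemxAr mulmx1.
exists v; first by split=> //; apply: mulmx1C.
move=> i; rewrite BE vE /v; congr (_ *: _).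
by rewrite -!scalemxAl -scalemxAr scalerA divff // scale1r.
Qed.

End FixedPoint.
End Adjoint.

(** * Complex phases *)

Section Phase.
Variable R : realType.

Lemma norm_expi (a : R) : `|expi a| = 1.
Proof. by rewrite normc_def /= cos2Dsin2 sqrtr1. Qed.

Lemma cos_sin_surj (x y : R) : x ^+ 2 + y ^+ 2 = 1 -> exists a, cos a = x /\ sin a = y.
Proof.
move=> xy; have x1 : -1 <= x <= 1.
  by rewrite -ler_norml -(expr_le1 (n := 2)) // real_normK ?num_real // -xy lerDl sqr_ge0.
have s : sin (acos x) = `|y|.
  by rewrite sin_acos // -xy addrAC subrr add0r sqrtr_sqr.
have [y0|y0] := leP 0 y; first by exists (acos x); rewrite acosK ?s ?ger0_norm.
by exists (- acos x); rewrite cosN sinN acosK // s ltr0_norm // opprK.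
Qed.

Lemma expi_surj (c : R[i]) : `|c| = 1 -> exists a, c = expi a.
Proof.
move=> /(congr1 (fun x => x ^+ 2)); rewrite -add_Re2_Im2 expr1n => /(@complexI R).
case: c => x y /= /cos_sin_surj[a [<- <-]]; by exists a.
Qed.

(** These conditions express unitarity of [a 1 + b u] for a traceless self-adjoint involution [u];
    the conclusion reads it as a phase times [e^{i theta u}]. Seen as plane vectors, [a] and [b] are
    orthogonal, so for [a != 0] the number [b] is a real multiple of [i a]. *)
Lemma orthogonal_phase (a b : R[i]) : `|a| ^+ 2 + `|b| ^+ 2 = 1 -> a * b^* + b * a^* = 0 ->
  exists psi theta, a = expi psi * (cos theta)%:C%C /\ b = expi psi * Complex 0 (sin theta).
Proof.
case: a b => [a1 a2] [b1 b2]; rewrite -!add_Re2_Im2 -rmorphD => /(@complexI R) /= ab1.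
move=> /eqP; rewrite eq_complex /= => /andP[/eqP ab0 _].
have {}ab0 : a1 * b1 + a2 * b2 = 0 by lra.
have [a0|a0] := eqVneq (a1 ^+ 2 + a2 ^+ 2) 0.
  have a10 : a1 = 0 by apply/eqP; rewrite -sqrf_eq0; apply/eqP; nra.
  have a20 : a2 = 0 by apply/eqP; rewrite -sqrf_eq0; apply/eqP; nra.
  (* With [a = 0] and [theta = pi / 2], the phase must be [- i b]. *)
  have [psi [c s]] : exists t, cos t = b2 /\ sin t = - b1 by apply: cos_sin_surj; lra.
  exists psi, (pi / 2); rewrite cos_pihalf sin_pihalf /expi c s a10 a20.
  by split; apply/eqP; rewrite eq_complex /= !mulr0 ?mulr1 ?subr0 ?addr0 ?sub0r ?add0r ?opprK !eqxx.
set r2 := a1 ^+ 2 + a2 ^+ 2 in a0 *.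
pose r := Num.sqrt r2.
have rr : r ^+ 2 = r2 by rewrite sqr_sqrtr // addr_ge0 ?sqr_ge0.
have r0 : r != 0 by rewrite -sqrf_eq0 rr.
have [psi [c s]] : exists t, cos t = a1 / r /\ sin t = a2 / r.
  by apply: cos_sin_surj; rewrite !expr_div_n -mulrDl rr -/r2 divff.
(* The coordinate of [b] along the unit vector [i a / r]. *)
pose y := (a1 * b2 - a2 * b1) / r.
have y2 : y ^+ 2 = b1 ^+ 2 + b2 ^+ 2.
  rewrite expr_div_n rr; apply: (mulIf a0); rewrite divfK // /r2.
  have -> : (a1 * b2 - a2 * b1) ^+ 2 = (b1 ^+ 2 + b2 ^+ 2) * (a1 ^+ 2 + a2 ^+ 2)
     - (a1 * b1 + a2 * b2) ^+ 2 by ring.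
  by rewrite ab0 expr0n subr0.
have [theta [c' s']] : exists t, cos t = r /\ sin t = y by apply: cos_sin_surj; rewrite rr y2.
exists psi, theta; rewrite /expi c s c' s'.
split; apply/eqP; rewrite eq_complex /=; apply/andP; split; apply/eqP.
- by rewrite mulr0 subr0 divfK.
- by rewrite mulr0 add0r divfK.
- rewrite mulr0 sub0r /y mulrACA -invfM -expr2 rr; apply: (mulIf a0); rewrite mulNr divfK // /r2.
  have -> : - (a2 * (a1 * b2 - a2 * b1)) = b1 * (a1 ^+ 2 + a2 ^+ 2)
     - a1 * (a1 * b1 + a2 * b2) by ring.
  by rewrite ab0 mulr0 subr0.
- rewrite mulr0 addr0 /y mulrACA -invfM -expr2 rr; apply: (mulIf a0); rewrite divfK // /r2.
  have -> : a1 * (a1 * b2 - a2 * b1) = b2 * (a1 ^+ 2 + a2 ^+ 2)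
     - a2 * (a1 * b1 + a2 * b2) by ring.
  by rewrite ab0 mulr0 subr0.
Qed.

End Phase.

(** * Tensor products and Pauli matrices *)

Section Tensor.
Variable R : realType.
Local Notation C := R[i].

Lemma mxtrace_tens m k (M : 'M[C]_m) (M' : 'M[C]_k) : \tr (M *t M') = \tr M * \tr M'.
Proof.
rewrite /mxtrace mulr_suml.
under [RHS]eq_bigr do rewrite mulr_sumr.
rewrite pair_big /= (reindex (@mxtens_index m k)) /=; last first.
  by exists (@mxtens_unindex m k) => x _; [apply: mxtens_indexK | apply: mxtens_unindexK].
by apply: eq_bigr => [[i j]] _; rewrite tensmxE.
Qed.

Lemma tensDr m k (S : 'M[C]_m) (X Y : 'M[C]_k) : S *t (X + Y) = S *t X + S *t Y.
Proof. by apply/matrixP=> i j; rewrite !mxE mulrDr. Qed.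

Lemma tensZr m k a (S : 'M[C]_m) (X : 'M[C]_k) : S *t (a *: X) = a *: (S *t X).
Proof. by apply/matrixP=> i j; rewrite !mxE mulrCA. Qed.

Lemma tensZl m k a (S : 'M[C]_m) (X : 'M[C]_k) : (a *: S) *t X = a *: (S *t X).
Proof. by apply/matrixP=> i j; rewrite !mxE mulrA. Qed.

Lemma tensDl m k (S S' : 'M[C]_m) (X : 'M[C]_k) : (S + S') *t X = S *t X + S' *t X.
Proof. by apply/matrixP=> i j; rewrite !mxE mulrDl. Qed.

Lemma tens1_inj m k (X Y : 'M[C]_k) : (1%:M : 'M_m.+1) *t X = 1%:M *t Y -> X = Y.
Proof.
move=> /matrixP h; apply/matrixP=> i j.
have := h (mxtens_index (0, i)) (mxtens_index (0, j)).
by rewrite !tensmxE !mxE eqxx !mul1r.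
Qed.

Lemma tens1_comm m k (X : 'M[C]_(m * k.+1)) :
  (forall M : 'M_k.+1, X *m (1%:M *t M) = (1%:M *t M) *m X) ->
  X = (\matrix_(i, j) X (mxtens_index (i, 0)) (mxtens_index (j, 0))) *t 1%:M.
Proof.
have sumE (G : 'I_(m * k.+1) -> C) : \sum_j G j = \sum_i \sum_j G (mxtens_index (i, j)).
  rewrite pair_big /= (reindex (@mxtens_index m k.+1)) /=; first by apply: eq_bigr => [[]].
  by exists (@mxtens_unindex m k.+1) => x _; [apply: mxtens_indexK | apply: mxtens_unindexK].
move=> h; apply/matrixP=> i j.
case: (mxtens_indexP i) => i1 i2; case: (mxtens_indexP j) => j1 j2; rewrite [RHS]tensmxE !mxE.
(* Against this matrix unit, the left side isolates entry [((i1, i2), (j1, j2))] of [X], the right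
   side entry [((i1, 0), (j1, 0))] if [i2 = j2] and zero otherwise. *)
have /matrixP/(_ (mxtens_index (i1, i2)) (mxtens_index (j1, 0))) := h (delta_mx j2 0).
rewrite !mxE !sumE (bigD1 j1) //= [X in _ + X = _]big1 => [|a aj]; last first.
  by rewrite big1 // => b _; rewrite tensmxE !mxE (negbTE aj) mul0r mulr0.
rewrite (bigD1 j2) //= [X in _ + X + _ = _]big1 => [|b bj]; last first.
  by rewrite tensmxE !mxE (negbTE bj) !mulr0.
rewrite tensmxE !mxE !eqxx !mulr1 !addr0 => ->.
rewrite (bigD1 i1) //= [X in _ + X = _]big1 => [|a aj]; last first.
  by rewrite big1 // => b _; rewrite tensmxE !mxE eq_sym (negbTE aj) !mul0r.
rewrite (bigD1 0) //= [X in _ + X + _ = _]big1 => [|b bj]; last first.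
  by rewrite tensmxE !mxE (negbTE bj) andbF mulr0 mul0r.
by rewrite !tensmxE !mxE !eqxx !mul1r !addr0 andbT mulrC.
Qed.

Definition sx (b : bool) : 'M[C]_2 := if b then @sigma_x R else 1%:M.

Lemma sxM b b' : sx b *m sx b' = sx (b (+) b').
Proof.
case: b b' => [] [] /=; rewrite ?mul1mx ?mulmx1 //.
by apply/matrixP=> i j; rewrite !mxE big_ord_recl big_ord1 !mxE;
  case: i => [[|[|]]] //= ?; case: j => [[|[|]]] //= ?;
  rewrite ?mulr0 ?mulr1 ?mul0r ?addr0 ?add0r.
Qed.

Lemma adj_sx b : adj (sx b) = sx b.
Proof.
case: b; last by rewrite /= adj_1mx.
apply/matrixP=> i j; rewrite adjE !mxE eq_sym.
by case: eqP; rewrite ?rmorph0 ?rmorph1.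
Qed.

Lemma tr_sx b : \tr (sx b) = if b then 0 else 2%:R.
Proof. by case: b; rewrite /= ?mxtrace1 // /mxtrace big1 // => i _; rewrite mxE eqxx. Qed.

Lemma sx_comm (Y : 'M[C]_2) : Y *m sx true = sx true *m Y ->
  Y = Y 0 0 *: 1%:M + Y 0 1 *: sx true.
Proof.
move=> /matrixP h; have I2 (i : 'I_2) : i = 0 \/ i = 1.
  by case: i => [[|[|]]] // ?; [left | right]; apply/val_inj.
have e1 : lift ord0 ord0 = 1 :> 'I_2 by apply/val_inj.
have h01 : Y 0 0 = Y 1 1.
  have := h 0 1; rewrite !mxE !big_ord_recl !big_ord0 !mxE e1 /=.
  by rewrite ?mulr0 ?mulr1 ?mul0r ?mul1r ?addr0 ?add0r.
have h00 : Y 0 1 = Y 1 0.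
  have := h 0 0; rewrite !mxE !big_ord_recl !big_ord0 !mxE e1 /=.
  by rewrite ?mulr0 ?mulr1 ?mul0r ?mul1r ?addr0 ?add0r.
apply/matrixP=> i j; case: (I2 i) => ->; case: (I2 j) => ->;
  by rewrite !mxE /= ?mulr0 ?mulr1 ?addr0 ?add0r.
Qed.

Lemma adj_sz : adj (@sigma_z R) = sigma_z R.
Proof.
apply/matrixP=> i j; rewrite adjE !mxE eq_sym.
by case: eqP => [->|]; rewrite ?rmorph0 //; case: ifP; rewrite ?rmorphN ?rmorph1.
Qed.

Lemma sz_unitary k : unitary (if k then @sigma_z R else 1%:M).
Proof.
case: k; last by rewrite /unitary adj_1mx mulmx1.
rewrite /unitary adj_sz; suff -> : sigma_z R *m sigma_z R = 1%:M by [].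
by apply/matrixP=> i j; rewrite !mxE big_ord_recl big_ord1 !mxE;
  case: i => [[|[|]]] //= ?; case: j => [[|[|]]] //= ?;
  rewrite ?mulr0 ?mulr1 ?mul0r ?addr0 ?add0r ?mulrNN ?mulr1.
Qed.

(** Realises the sign left over by [trace_rigidity] as a unitary conjugation on the first tensor
    factor. *)
Lemma sz_conj (k b : bool) (S := if k then @sigma_z R else 1%:M) :
  adj S *m sx b *m S = (-1) ^+ (k && b) *: sx b.
Proof.
rewrite /S {S}; case: k; last by rewrite adj_1mx mul1mx mulmx1 scale1r.
case: b; last by rewrite mulmx1 scale1r (sz_unitary true).2.
rewrite adj_sz expr1; apply/matrixP=> i j.
rewrite !mxE big_ord_recl big_ord1 !mxE !big_ord_recl !big_ord0 !mxE.
by case: i => [[|[|]]] //= ?; case: j => [[|[|]]] //= ?;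
  rewrite ?(mulr0, mulr1, mul0r, mul1r, addr0, add0r, oppr0).
Qed.

End Tensor.

(** * Translation between words indexed by ordinals and lists of letters *)

Section FfunWords.
Variables (R : realType) (N : nat) (par : 'I_N -> bool).
Local Notation C := R[i].

Definition ffseq {L} (s : {ffun 'I_L -> 'I_N}) : seq 'I_N := [seq s k | k <- enum 'I_L].

Lemma size_ffseq L (s : {ffun 'I_L -> 'I_N}) : size (ffseq s) = L.
Proof. by rewrite size_map size_enum_ord. Qed.

Lemma ffseq_surj (t : seq 'I_N) : exists s : {ffun 'I_(size t) -> 'I_N}, ffseq s = t.
Proof.
exists [ffun k => tnth (in_tuple t) k]; rewrite /ffseq.
under eq_map do rewrite ffunE.
by rewrite map_tnth_enum.
Qed.

Lemma mxword_ffseq n (B : 'I_N -> 'M[C]_n) L (s : {ffun 'I_L -> 'I_N}) :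
  mxword B s = word B (ffseq s).
Proof.
rewrite /mxword /ffseq [index_enum _]unlock -enumT; elim: (enum _) => [|k r IH] /=; first by rewrite big_nil.
by rewrite big_cons IH.
Qed.

Lemma wpar_ffseq L (s : {ffun 'I_L -> 'I_N}) : wpar par s = spar par (ffseq s).
Proof.
rewrite /wpar /ffseq [index_enum _]unlock -enumT; elim: (enum _) => [|k r IH] /=; first by rewrite big_nil.
by rewrite big_cons oddD IH oddb.
Qed.

Lemma spans_parity_full n (B : 'I_N -> 'M[C]_n) l b : spans_parity par B l b -> full par B b l.
Proof.
move=> h X; have [c ->] := h X; exists (\sum_(s | wpar par s == b) c s *: mxword B s).
apply: wspan_sum => s /eqP <-; apply: wspanZ.
by rewrite wpar_ffseq mxword_ffseq -[X in wspan _ _ _ _ X](size_ffseq s); apply: wspan_word.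
Qed.

End FfunWords.

(** * The graded embedding of [n x n] matrices, its commutant and its intertwiners *)

Section Embedding.
Variables (R : realType) (N n : nat) (par : 'I_N -> bool).
Local Notation C := R[i].
Variables (W : 'M[C]_(2 * n.+1)) (B : 'I_N -> 'M[C]_n.+1) (A : 'I_N -> 'M[C]_(2 * n.+1)).
Hypothesis Wu : unitary W.

(** Multiplicative with parities added and compatible with adjoints; [A i] is [emb (par i) (B i)]
    and the Wall matrix is [emb true 1%:M]. *)
Definition emb b (X : 'M[C]_n.+1) : 'M[C]_(2 * n.+1) := W *m (sx R b *t X) *m adj W.

Hypothesis AE : forall i, A i = emb (par i) (B i).

Lemma embM b b' X X' : emb b X *m emb b' X' = emb (b (+) b') (X *m X').
Proof.
rewrite /emb !mulmxA -(mulmxA _ (adj W) W) Wu.2 mulmx1 -(mulmxA W).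
by rewrite tensmx_mul sxM.
Qed.

Lemma embD b X X' : emb b (X + X') = emb b X + emb b X'.
Proof. by rewrite /emb tensDr mulmxDr mulmxDl. Qed.

Lemma embZ b a X : emb b (a *: X) = a *: emb b X.
Proof. by rewrite /emb tensZr -scalemxAr -scalemxAl. Qed.

Lemma emb_0 b : emb b 0 = 0.
Proof. by rewrite -(scale0r 0) embZ scale0r. Qed.

Lemma emb_sum b (I : finType) (X : I -> 'M_n.+1) : emb b (\sum_i X i) = \sum_i emb b (X i).
Proof. by elim/big_rec2: _ => [|i Y Z _ <-]; rewrite ?emb_0 ?embD. Qed.

Lemma emb_1 : emb false 1%:M = 1%:M.
Proof. by rewrite /emb tens11 mulmx1 Wu.1. Qed.

Lemma adj_emb b X : adj (emb b X) = emb b (adj X).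
Proof. by rewrite /emb !adjM adjK adj_tens adj_sx mulmxA. Qed.

Lemma mxtrace_emb b X : \tr (emb b X) = if b then 0 else 2%:R * \tr X.
Proof.
rewrite /emb mxtrace_mulC mulmxA Wu.2 mul1mx mxtrace_tens tr_sx.
by case: b; rewrite ?mul0r.
Qed.

Lemma emb_inj X Y : emb false X = emb false Y -> X = Y.
Proof.
move=> /(congr1 (fun M => adj W *m M *m W)); rewrite /emb !mulmxA Wu.2 !mul1mx.
by rewrite -!mulmxA Wu.2 !mulmx1 => /tens1_inj.
Qed.

Lemma word_emb t : word A t = emb (spar par t) (word B t).
Proof. by elim: t => [|i t IH] /=; rewrite ?emb_1 // AE IH embM. Qed.

Lemma wspan_emb b L M X : wspan par A B b L M X -> M = emb b X.
Proof.
elim=> [|a t M' Y _ <- _ ->]; first by rewrite emb_0.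
by rewrite word_emb embD embZ.
Qed.

Lemma canonical_emb : fMPS_canonical A -> \sum_i B i *m adj (B i) = 1%:M.
Proof.
move=> h; apply: emb_inj; rewrite emb_1 -h emb_sum; apply: eq_bigr => i _.
by rewrite AE adj_emb embM addbb.
Qed.

(** In the frame of [W], commuting with all [1 *t M] forces the shape [Y *t 1]; commuting with
    [sigma_x *t 1] then puts [Y] in the span of [1] and [sigma_x]. *)
Lemma commutant_emb X : (forall b M, X *m emb b M = emb b M *m X) ->
  exists a c, X = a *: 1%:M + c *: emb true 1%:M.
Proof.
move=> h; pose X' := adj W *m X *m W.
have XE : X = W *m X' *m adj W.
  by rewrite /X' !mulmxA Wu.1 mul1mx -mulmxA Wu.1 mulmx1.
have h' b M : X' *m (sx R b *t M) = (sx R b *t M) *m X'.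
  have := congr1 (fun M => adj W *m M *m W) (h b M); rewrite /emb /X' => {}h.
  transitivity (adj W *m (X *m (W *m (sx R b *t M) *m adj W)) *m W).
    by rewrite -!mulmxA Wu.2 mulmx1.
  by rewrite h !mulmxA Wu.2 mul1mx.
have X'E := tens1_comm (h' false); set Y := (X in X' = X *t _) in X'E.
have YY : Y *m sx R true = sx R true *m Y.
  have := h' true 1%:M; rewrite X'E !tensmx_mul mulmx1 => /matrixP h1.
  apply/matrixP=> i j; have := h1 (mxtens_index (i, 0)) (mxtens_index (j, 0)).
  by rewrite !tensmxE [1%:M 0 0]mxE eqxx !mulr1.
exists (Y 0 0), (Y 0 1); rewrite XE X'E {1}(sx_comm YY) tensDl !tensZl tens11.
by rewrite mulmxDr mulmxDl -!scalemxAr -!scalemxAl mulmx1 Wu.1.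
Qed.

Section Intertwiner.
Variables (l : nat).
Hypothesis fullB : forall b, full par B b l.
Hypothesis canB : \sum_i B i *m adj (B i) = 1%:M.
Variables (X : 'M[C]_(2 * n.+1)) (w : C).
Hypothesis XA : forall i, X *m A i = w *: (A i *m X).

Lemma intertwine_emb L b M : (l <= L)%N -> X *m emb b M = w ^+ L *: (emb b M *m X).
Proof.
(* The combination of [B]-words that yields [M], evaluated on the [A i], yields [emb b M]; each of
   its words contributes the factor [w ^+ L]. *)
move=> lL; have [Y /wspan_sym] := full_image A M (full_geq canB fullB lL b).
move=> h; rewrite -(wspan_emb h).
elim: h => [|a t Z Z' st _ _ IH]; first by rewrite mul0mx mulmx0 scaler0.
rewrite mulmxDr mulmxDl scalerDr IH -scalemxAr -scalemxAl scalerA mulrC -scalerA.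
congr (_ *: _ + _); rewrite -st {st}; elim: t => [|i t IHt] /=.
  by rewrite mulmx1 mul1mx scale1r.
by rewrite mulmxA XA -scalemxAl -mulmxA IHt -scalemxAr scalerA mulmxA exprS.
Qed.

(* Both lengths [l] and [l+1] produce the identity. *)
Lemma intertwine_phase : X != 0 -> w = 1.
Proof.
move=> X0; have h L : (l <= L)%N -> w ^+ L = 1.
  move=> lL; have := intertwine_emb false 1%:M lL; rewrite emb_1 mulmx1 mul1mx => /eqP.
  rewrite -[X in X == _]scale1r -subr_eq0 -scalerBl scaler_eq0 (negbTE X0) orbF.
  by rewrite subr_eq0 eq_sym => /eqP.
by have := h _ (leqnSn l); rewrite exprS h // mulr1.
Qed.

Lemma intertwine_commutant : w = 1 -> exists a c, X = a *: 1%:M + c *: emb true 1%:M.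
Proof.
move=> w1; apply: commutant_emb => b M.
by rewrite (intertwine_emb b M (leqnn l)) w1 expr1n scale1r.
Qed.

End Intertwiner.
End Embedding.

(** * Comparison of two tensors: existence, Wall matrices, uniqueness *)

Section Pair.
Variables (R : realType) (N n : nat) (par : 'I_N -> bool).
Local Notation C := R[i].
Variables (W : 'M[C]_(2 * n.+1)) (B : 'I_N -> 'M[C]_n.+1) (A : 'I_N -> 'M[C]_(2 * n.+1)).
Variables (W' : 'M[C]_(2 * n.+1)) (B' : 'I_N -> 'M[C]_n.+1) (A' : 'I_N -> 'M[C]_(2 * n.+1)).
Variables (l l' : nat).
Hypotheses (Wu : unitary W) (Wu' : unitary W').
Hypothesis AE : forall i, A i = emb W (par i) (B i).
Hypothesis AE' : forall i, A' i = emb W' (par i) (B' i).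
Hypothesis fullB : forall b, full par B b l.
Hypothesis fullB' : forall b, full par B' b l'.
Hypotheses (canA : fMPS_canonical A) (canA' : fMPS_canonical A').

Variables (u u' : 'M[C]_(2 * n.+1)).
Hypotheses (uE : u = emb W true 1%:M) (uE' : u' = emb W' true 1%:M).
Let canB := canonical_emb Wu AE canA.
Let canB' := canonical_emb Wu' AE' canA'.

(** Serves both equivalences: [b0] is even for [gauge_equiv] and odd for [gauge_equiv_PBC]. *)
Lemma related_of_trace (b0 : bool) :
  (forall L, exists alpha, forall s : {ffun 'I_L -> 'I_N}, wpar par s = b0 ->
     \tr (mxword B s) = expi alpha * \tr (mxword B' s)) ->
  exists V beta, related A A' V beta.
Proof.
move=> /choice[alpha htr].
(* From length [maxn l l'] on, both families span in each parity. *)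
have [||||T [lam [k [Tu lam1 BE]]]] :=
    @trace_rigidity _ _ _ par B B' (maxn l l') b0 (fun L => expi (alpha L)).
- by move=> b L; rewrite geq_max => /andP[lL _]; apply: (full_geq canB fullB lL).
- by move=> b L; rewrite geq_max => /andP[_ lL]; apply: (full_geq canB' fullB' lL).
- by move=> L; apply: norm_expi.
- move=> t; have [s <-] := ffseq_surj t; rewrite -wpar_ffseq -!mxword_ffseq size_ffseq.
  exact: htr.
pose sg i : C := (-1) ^+ (k && par i).
have sg1 i : `|lam * sg i| = 1 by rewrite normrM lam1 normrX normrN1 expr1n mulr1.
have [v vu vE] := unitary_of_canonical canB (fullB false) Tu sg1 BE canB'.
pose S := if k then @sigma_z R else 1%:M; have Su : unitary S := sz_unitary R k.
have [beta lamE] := expi_surj lam1.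
(* [S] produces the sign, [v] conjugates the [B i], and [W], [W'] change frames. *)
exists (W *m (S *t v) *m adj W'), beta; split.
  by do 2?apply: unitary_mul => //; [apply: unitary_tens | apply: unitary_adj].
move=> i; rewrite AE' AE vE lamE -scalerA !embZ; congr (_ *: _).
rewrite !adjM adjK adj_tens /emb !mulmxA -(mulmxA _ (adj W) W) Wu.2 mulmx1.
rewrite -(mulmxA _ (adj W) W) Wu.2 mulmx1.
rewrite -[in RHS](mulmxA W') tensmx_mul -[in RHS](mulmxA W') tensmx_mul sz_conj tensZl.
by rewrite -scalemxAr -scalemxAl.
Qed.

Lemma gauge_trace : gauge_equiv A A' -> forall L, exists alpha,
  forall s : {ffun 'I_L -> 'I_N}, wpar par s = false ->
     \tr (mxword B s) = expi alpha * \tr (mxword B' s).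
Proof.
move=> h L; have [alpha ha] := h L; exists alpha => s ps.
have := ha s; rewrite !mxword_ffseq (word_emb Wu AE) (word_emb Wu' AE') -wpar_ffseq ps.
rewrite !mxtrace_emb // mulrCA => /mulfI; apply.
by rewrite pnatr_eq0.
Qed.

Lemma gauge_PBC_trace : gauge_equiv_PBC A A' u u' -> forall L, exists alpha,
  forall s : {ffun 'I_L -> 'I_N}, wpar par s = true ->
     \tr (mxword B s) = expi alpha * \tr (mxword B' s).
Proof.
move=> h L; have [alpha ha] := h L; exists alpha => s ps.
have := ha s; rewrite !mxword_ffseq (word_emb Wu AE) (word_emb Wu' AE') -wpar_ffseq ps.
rewrite uE uE' !embM // !mul1mx !mxtrace_emb // mulrCA => /mulfI; apply.
by rewrite pnatr_eq0.
Qed.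

Lemma related_word V beta : related A A' V beta -> forall t,
  word A' t = expi beta ^+ size t *: (adj V *m word A t *m V).
Proof.
case=> Vu VE; elim=> [|i t IH] /=; first by rewrite scale1r mulmx1 Vu.2.
rewrite VE IH -scalemxAl -scalemxAr scalerA exprS !mulmxA -(mulmxA _ V) Vu.1 mulmx1.
by [].
Qed.

(** The conjugate of [u] by [V] commutes with every [A' i], hence is [a 1 + c u']. Its trace is
    zero, so [a = 0]; its square is 1, so [c] is a sign. *)
Lemma related_wall V beta : related A A' V beta ->
  exists eta : bool, u' = (-1) ^+ eta *: (adj V *m u *m V).
Proof.
move=> [Vu VE]; pose X := adj V *m u *m V.
have uA i : u *m A i = A i *m u by rewrite AE uE !embM // mul1mx mulmx1 addbC.
have XA i : X *m A' i = 1 *: (A' i *m X).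
  rewrite VE scale1r /X -scalemxAr -scalemxAl; congr (_ *: _).
  rewrite !mulmxA -[in RHS](mulmxA _ V) -[in LHS](mulmxA _ V) Vu.1 !mulmx1.
  by rewrite -(mulmxA (adj V) u) uA !mulmxA.
have [a [c XE]] := intertwine_commutant Wu' AE' fullB' canB' XA erefl.
rewrite -uE' in XE.
have a0 : a = 0.
  have : \tr X = 0 by rewrite /X mxtrace_mulC mulmxA Vu.1 mul1mx uE mxtrace_emb.
  rewrite XE mxtraceD !mxtraceZ uE' mxtrace_emb // mulr0 addr0 mxtrace1 => /eqP.
  by rewrite mulf_eq0 pnatr_eq0 orbF => /eqP.
have uu : u *m u = 1%:M by rewrite uE embM // mul1mx addbb emb_1.
have uu' : u' *m u' = 1%:M by rewrite uE' embM // mul1mx addbb emb_1.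
have XX : X *m X = 1%:M.
  by rewrite /X !mulmxA -(mulmxA _ V) Vu.1 mulmx1 -(mulmxA _ u u) uu mulmx1 Vu.2.
rewrite a0 scale0r add0r in XE.
have /eqP : c ^+ 2 = 1.
  have /(congr1 mxtrace) := XX; rewrite XE -scalemxAl -scalemxAr scalerA uu' mxtraceZ mxtrace1.
  by rewrite -[RHS]mul1r => /mulIf; apply; rewrite pnatr_eq0.
have -> : adj V *m u *m V = c *: u' by [].
rewrite sqrf_eq1 => /orP[]/eqP->; first by exists false; rewrite expr0 !scale1r.
by exists true; rewrite expr1 scalerA mulrNN mulr1 scale1r.
Qed.

Lemma related_gauge V beta : related A A' V beta -> gauge_equiv A A'.
Proof.
move=> rel L; have [a aE] : exists a, (expi beta ^+ L)^-1 = expi a.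
  by apply: expi_surj; rewrite normfV normrX norm_expi expr1n invr1.
exists a => s; rewrite !mxword_ffseq (related_word rel) size_ffseq mxtraceZ mxtrace_mulC.
rewrite mulmxA rel.1.1 mul1mx mulrA -aE mulVf ?mul1r // expf_neq0 //.
by rewrite -normr_eq0 norm_expi oner_eq0.
Qed.

Lemma related_gauge_PBC V beta : related A A' V beta -> gauge_equiv_PBC A A' u u'.
Proof.
move=> rel L; have [eta uEta] := related_wall rel.
have e0 : expi beta != 0 by rewrite -normr_eq0 norm_expi oner_eq0.
(* The sign between the Wall matrices is absorbed into the phase of each length. *)
have [a aE] : exists a, ((-1) ^+ eta * expi beta ^+ L)^-1 = expi a.
  by apply: expi_surj; rewrite normfV normrM !normrX norm_expi normrN1 !expr1n mulr1 invr1.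
exists a => s; rewrite !mxword_ffseq (related_word rel) size_ffseq uEta.
rewrite -scalemxAl -scalemxAr scalerA mxtraceZ !mulmxA -(mulmxA _ V) rel.1.1 mulmx1.
rewrite [in RHS]mxtrace_mulC !mulmxA rel.1.1 mul1mx mulrA -aE mulVf ?mul1r //.
by rewrite mulf_neq0 ?expf_neq0 // oppr_eq0 oner_eq0.
Qed.

(** The unitary [V2 *m adj V1] intertwines the [A i] with themselves up to the quotient of the
    phases. An overall phase of [V] is invisible to conjugation, hence the factor [expi psi]. *)
Lemma related_unique V1 b1 V2 b2 : related A A' V1 b1 -> related A A' V2 b2 ->
  expi b1 = expi b2 /\ exists psi theta, V2 = expi psi *: (expiu theta u *m V1).
Proof.
move=> [V1u V1E] [V2u V2E]; pose X := V2 *m adj V1.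
have e0 b : expi b != 0 :> C by rewrite -normr_eq0 norm_expi oner_eq0.
have XA i : X *m A i = (expi b2 / expi b1) *: (A i *m X).
  have := congr1 (fun M => (expi b1)^-1 *: (V2 *m M *m adj V1)) (V1E i); rewrite {1}V2E.
  rewrite -!scalemxAr -!scalemxAl !scalerA mulVf // scale1r [_^-1 * _]mulrC => h.
  rewrite /X; symmetry; move: h; rewrite !mulmxA V2u.1 mul1mx => ->.
  by rewrite -!mulmxA V1u.1 mulmx1.
have Xu : unitary X by apply: unitary_mul => //; apply: unitary_adj.
have X0 : X != 0.
  apply/eqP => X0; have /matrixP/(_ ord0 ord0)/eqP := Xu.1.
  by rewrite X0 mul0mx !mxE eqxx eq_sym oner_eq0.
have w1 := intertwine_phase Wu AE fullB canB XA X0.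
split; first by rewrite -[LHS]mul1r -w1 divfK.
have [a [c XE]] := intertwine_commutant Wu AE fullB canB XA w1.
rewrite -uE in XE.
have uu : u *m u = 1%:M by rewrite uE embM // mul1mx addbb emb_1.
have au : adj u = u by rewrite uE adj_emb adj_1mx.
have tru : \tr u = 0 by rewrite uE mxtrace_emb.
have XX : X *m adj X = (a * a^* + c * c^*) *: 1%:M + (a * c^* + c * a^*) *: u.
  rewrite XE adjD !adjZ adj_1mx au mulmxDl !mulmxDr -!scalemxAl -!scalemxAr !scalerA.
  rewrite mulmx1 !mul1mx mulmx1 uu !scalerDl; by rewrite [RHS]addrACA [X in _ = _ + X]addrC.
have n0 : (2 * n.+1)%:R != 0 :> C by rewrite pnatr_eq0.
(* Since [u] is traceless with square 1, the trace, taken plainly and then against [u], separates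
   the coefficients of [1] and [u]. *)
have ac1 : a * a^* + c * c^* = 1.
  have := congr1 mxtrace Xu.1; rewrite XX mxtraceD !mxtraceZ tru mulr0 addr0 mxtrace1.
  by rewrite -[RHS]mul1r => /(mulIf n0).
have ac0 : a * c^* + c * a^* = 0.
  have := congr1 (fun M => \tr (M *m u)) Xu.1; rewrite XX mulmxDl -!scalemxAl mul1mx uu.
  rewrite mxtraceD !mxtraceZ tru mulr0 add0r mxtrace1 => /eqP.
  by rewrite mulf_eq0 (negbTE n0) orbF => /eqP.
have [|psi [theta [aE cE]]] := @orthogonal_phase _ a c _ ac0; first by rewrite !normCK.
exists psi, theta.
rewrite /expiu scalemxAl scalerDr !scalerA -aE -cE -XE /X -mulmxA V1u.2 mulmx1.
by [].
Qed.

Lemma expiu_unitary theta : unitary (expiu theta u).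
Proof.
have uu : u *m u = 1%:M by rewrite uE embM // mul1mx addbb emb_1.
have au : adj u = u by rewrite uE adj_emb adj_1mx.
have e : expiu theta u *m adj (expiu theta u) = 1%:M.
  rewrite /expiu; set a := (_%:C)%C; set c := Complex _ _.
  have aR : a^* = a by apply/eqP; rewrite eq_complex /= oppr0 !eqxx.
  have cR : c^* = - c by apply/eqP; rewrite eq_complex /= oppr0 !eqxx.
  rewrite adjD !adjZ adj_1mx au aR cR mulmxDl !mulmxDr -!scalemxAl -!scalemxAr !scalerA.
  rewrite mulmx1 !mul1mx mulmx1 uu !mulrN [c * a]mulrC scaleNr addrA subrK -scalerDl.
  suff -> : a * a - c * c = 1 by rewrite scale1r.
  apply/eqP; rewrite eq_complex /= ?(mulr0, mul0r, subr0, addr0, add0r, oppr0, sub0r, opprK).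
  by rewrite -!expr2 cos2Dsin2 !eqxx.
by split=> //; apply: mulmx1C.
Qed.

Lemma expiu_comm theta i : expiu theta u *m A i = A i *m expiu theta u.
Proof.
have uA : u *m A i = A i *m u by rewrite AE uE !embM // mul1mx mulmx1 addbC.
by rewrite /expiu mulmxDl mulmxDr -!scalemxAl -!scalemxAr mul1mx mulmx1 uA.
Qed.

End Pair.

Theorem mainTheorem2 (R : realType) (N n : nat) (par : 'I_N -> bool)
    (A At : 'I_N -> 'M[R[i]]_(2 * n)) (u ut : 'M[R[i]]_(2 * n)) :
  (1 <= N)%N -> (1 <= n)%N ->
  is_fMPS par A -> is_fMPS par At ->
  wall_minus par A u -> wall_minus par At ut ->
  fMPS_canonical A -> fMPS_canonical At ->
  (* existence, for ~ and for ~_PBC *)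
  (gauge_equiv A At <-> exists V beta, related A At V beta) /\
  (gauge_equiv_PBC A At u ut <-> exists V beta, related A At V beta) /\
  (* uniqueness of the phase and of V up to e^{i psi} e^{i theta u} V e^{i phi ut} *)
  (forall V1 b1 V2 b2, related A At V1 b1 -> related A At V2 b2 ->
     expi b1 = expi b2 /\
     exists psi theta phi : R,
       V2 = expi psi *: (expiu theta u *m V1 *m expiu phi ut)) /\
  (forall V1 b1, related A At V1 b1 -> forall psi theta phi : R,
     related A At (expi psi *: (expiu theta u *m V1 *m expiu phi ut)) b1) /\
  (* Wall matrices are related by V *)
  (forall V b, related A At V b ->
     exists eta : bool, ut = (-1) ^+ eta *: (adj V *m u *m V)).
Proof.
(* A successor dimension provides the entry [0 0] and a nonzero trace of the identity. *)
case: n A At u ut => [|n] A At u ut _ // _ _ _.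
case=> W [B [Wu AE [l [s0 s1]] uE]] [Wt [Bt [Wtu AtE [lt [st0 st1]] utE]]] canA canAt.
have fB b : full par B b l by case: b; apply: spans_parity_full.
have fBt b : full par Bt b lt by case: b; apply: spans_parity_full.
split; [split | split; [split | split; [| split]]].
- by move/(gauge_trace Wu Wtu AE AtE)/(related_of_trace Wu Wtu AE AtE fB fBt canA canAt).
- by case=> V [beta rel]; apply: related_gauge rel.
- move/(gauge_PBC_trace Wu Wtu AE AtE uE utE).
  exact: (related_of_trace Wu Wtu AE AtE fB fBt canA canAt).
- by case=> V [beta rel]; apply: (related_gauge_PBC Wu Wtu AE AtE fBt canAt uE utE rel).
- move=> V1 b1 V2 b2 r1 r2.
  have [-> [psi [theta V2E]]] := related_unique Wu AE fB canA uE r1 r2.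
  (* By the relation between the Wall matrices, a right factor in [ut] can be moved to the left as
     one in [u], so [phi = 0] is enough. *)
  split=> //; exists psi, theta, 0; rewrite V2E /expiu cos0 sin0.
  have -> : Complex 0 0 = 0 :> R[i] by [].
  by rewrite scale0r addr0 scale1r mulmx1.
- move=> V1 b1 [V1u V1E] psi theta phi.
  have Su := expiu_unitary Wu uE theta; have Tu := expiu_unitary Wtu utE phi.
  split; first by apply: unitary_scale (norm_expi _) _; do 2?apply: unitary_mul.
  move=> i; rewrite adjZ -!scalemxAl -scalemxAr [X in _ = _ *: X]scalerA.
  rewrite [(expi psi)^* * _]mulrC -normCK norm_expi expr1n scale1r !adjM.
  set S := expiu theta u in Su *; set T := expiu phi ut in Tu *.
  have SA : adj S *m A i *m S = A i.
    by rewrite -mulmxA -(expiu_comm Wu AE uE) mulmxA Su.2 mul1mx.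
  (* Regrouped so that [S] cancels around [A i], and then [T] around [At i]. *)
  have -> : adj T *m (adj V1 *m adj S) *m A i *m (S *m V1 *m T) =
      adj T *m (adj V1 *m (adj S *m A i *m S) *m V1) *m T by rewrite !mulmxA.
  rewrite SA scalemxAl scalemxAr -V1E.
  by rewrite -mulmxA -(expiu_comm Wtu AtE utE) mulmxA Tu.2 mul1mx.
- by move=> V b rel; apply: (related_wall Wu Wtu AE AtE fBt canAt uE utE rel).
Qed.
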